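(* Let $f:\mathbb{R}^D\to\mathbb{R}$ be differentiable, $L$-smooth, and bounded: $f_{\mathrm{inf}}\le f(\theta)\le f_{\mathrm{sup}}$ for all $\theta$, with $f_{\mathrm{inf}},f_{\mathrm{sup}}$ finite. Fix $\beta_1,\beta_2\in[0,1)$, $\epsilon>0$, a deterministic $\theta_0\in\mathbb{R}^D$, and learning rates $\alpha_t$ with $a_1/\sqrt{t}\le\alpha_t\le a_2/\sqrt{t}$ for all $t\ge1$, for constants $0<a_1\le a_2$ (i.e. $\alpha_t=\Theta(1/\sqrt t)$). Run ADOPT: $v_0=g_0\odot g_0$, $m_1=g_1/\max\{\sqrt{v_0},\epsilon\}$, and for $t\ge1$: $$\theta_t=\theta_{t-1}-\alpha_t m_t,\quad v_t=\beta_2 v_{t-1}+(1-\beta_2)g_t\odot g_t,\quad m_{t+1}=\beta_1 m_t+(1-\beta_1)\frac{g_{t+1}}{\max\{\sqrt{v_t},\epsilon\}},$$ where $g_0$ is a random vector with $\mathbb{E}\|g_0\|^2\le G^2$ and, for $t\ge1$, $\mathbb{E}[g_t\mid g_0,\dots,g_{t-1}]=\nabla f(\theta_{t-1})$ and $\mathbb{E}\|g_t\|^2\le G^2$ ($G>0$ a constant). Then there is a constant $K$ independent of $T$ such that for all $T\ge1$, $$\min_{t=1,\dots,T}\Big\{\mathbb{E}\big[\|\nabla f(\theta_{t-1})\|^{4/3}\big]^{3/2}\Big\}\le K/\sqrt{T}.$$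
   Context: $L$-smooth means $\|\nabla f(x)-\nabla f(y)\|\le L\|x-y\|$ for all $x,y$, with $L>0$. Norms are Euclidean; $\odot$, square root, division and $\max\{\cdot,\epsilon\}$ act elementwise. *)

(* Defs.v *)
From HB Require Import structures.
From mathcomp Require Import all_boot all_order all_algebra.
From mathcomp Require Import all_classical all_reals all_analysis.
Set Implicit Arguments. Unset Strict Implicit. Unset Printing Implicit Defensive.
Import Order.TTheory GRing.Theory Num.Theory.
Import numFieldNormedType.Exports.
Local Open Scope classical_set_scope.
Local Open Scope ring_scope.

Section ADOPT.
Variables (R : realType) (D : nat).

Definition enorm (v : 'rV[R]_D) : R := Num.sqrt (\sum_(i < D) v 0 i ^+ 2).

Definition grad (f : 'rV[R]_D -> R) (x : 'rV[R]_D) : 'rV[R]_D :=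
  \row_(i < D) ('D_(delta_mx 0 i) f x).

Definition L_smooth (L : R) (f : 'rV[R]_D -> R) : Prop :=
  forall x y, enorm (grad f x - grad f y) <= L * enorm (x - y).

(* ADOPT state at step t (t >= 0): (theta_t, v_t, m_{t+1}),
   given the (deterministic) sequence of stochastic gradients g. *)
Fixpoint adopt_state (alpha : nat -> R) (b1 b2 eps : R) (th0 : 'rV[R]_D)
  (g : nat -> 'rV[R]_D) (t : nat) : 'rV[R]_D * 'rV[R]_D * 'rV[R]_D :=
  match t with
  | 0 =>
      let v0 := \row_i (g 0 0 i * g 0 0 i) in
      (th0, v0, \row_i (g 1 0 i / Num.max (Num.sqrt (v0 0 i)) eps))
  | t'.+1 =>
      let: (th, v, m) := adopt_state alpha b1 b2 eps th0 g t' in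
      let th' := th - alpha t'.+1 *: m in
      let v' := \row_i (b2 * v 0 i + (1 - b2) * (g t'.+1 0 i * g t'.+1 0 i)) in
      let m' := \row_i (b1 * m 0 i + (1 - b1) *
                          (g t'.+2 0 i / Num.max (Num.sqrt (v' 0 i)) eps)) in
      (th', v', m')
  end.

Definition adopt_theta alpha b1 b2 eps th0 g t : 'rV[R]_D :=
  (adopt_state alpha b1 b2 eps th0 g t).1.1.

End ADOPT.

Definition past_sigma {d} {T : measurableType d} {R : realType} {D : nat}
  (g : nat -> T -> 'rV[R]_D) (t : nat) : set (set T) :=
  <<s [set A | exists (s : nat) (i : 'I_D) (B : set R),
         (s < t)%N /\ measurable B /\ A = (fun w => g s w 0 i) @^-1` B] >>.

(* Main.v *)
Require Import Defs.
From HB Require Import structures.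
From mathcomp Require Import all_boot all_order all_algebra.
From mathcomp Require Import all_classical all_reals all_analysis.
From mathcomp Require Import measurable_realfun ring lra.
Set Implicit Arguments.
Unset Strict Implicit.
Unset Printing Implicit Defensive.

Import Order.TTheory GRing.Theory Num.Theory.
Import numFieldNormedType.Exports.
Local Open Scope classical_set_scope.
Local Open Scope ring_scope.

(* The potential is not [f] along the iterates but along the points
   [zeta k t] at which the iterates would be after [k] more steps with no new
   gradients.  Passing from [zeta k.+1 t] to [zeta k t.+1] only adds a multiple
   of the fresh gradient, normalised by a scaling known from the past, so in
   conditional expectation the descent lemma gains a multiple of
   [X = sum_i (d_i f)^2 / max (sqrt v_i) eps].  As [f] is bounded, so is its
   gradient, and [n + 1] such steps with [t] in the window [n, 2n] force
   [E X <= K / sqrt n] for some [t] in that window.  Weighted Young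
   [|grad f|^(4/3) <= lam X + W^2 / lam^2], with [W] bounding the scalings in
   mean square and [lam = n^(1/6)], gives the rate.  A finite lookahead [k]
   avoids any monotonicity assumption on the step sizes. *)

(** * Euclidean norm of row vectors *)

Lemma enorm_ge0 (R : realType) (D : nat) (v : 'rV[R]_D) : 0 <= enorm v.
Proof. exact: sqrtr_ge0. Qed.

Lemma sqr_enorm (R : realType) (D : nat) (v : 'rV[R]_D) :
  enorm v ^+ 2 = \sum_(i < D) v 0 i ^+ 2.
Proof. by rewrite sqr_sqrtr// sumr_ge0// => i _; exact: sqr_ge0. Qed.

Lemma normr_coord_le_enorm (R : realType) (D : nat) (v : 'rV[R]_D) i :
  `|v 0 i| <= enorm v.
Proof.
rewrite -sqrtr_sqr ler_wsqrtr// (bigD1 i)//= lerDl sumr_ge0// => j _.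
exact: sqr_ge0.
Qed.

Lemma enorm_le_sum (R : realType) (D : nat) (v : 'rV[R]_D) :
  enorm v <= \sum_(i < D) `|v 0 i|.
Proof.
have S0 : 0 <= \sum_(i < D) `|v 0 i| by exact: sumr_ge0.
rewrite -(ger0_norm S0) -sqrtr_sqr ler_wsqrtr// expr2 mulr_suml.
apply: ler_sum => i _; rewrite -real_normK ?num_real// expr2.
by apply: ler_wpM2l => //; rewrite (bigD1 i)//= lerDl sumr_ge0.
Qed.

Lemma cauchy_schwarz (R : realType) (D : nat) (u v : 'rV[R]_D) :
  \sum_(i < D) u 0 i * v 0 i <= enorm u * enorm v.
Proof.
have [|u0] := leP (enorm u) 0.
  move=> u0; rewrite big1 ?mulr_ge0 ?enorm_ge0// => i _.
  have /normr0_eq0-> : `|u 0 i| = 0; last by rewrite mul0r.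
  by apply/le_anti; rewrite normr_ge0 (le_trans (normr_coord_le_enorm _ i)).
have [|v0] := leP (enorm v) 0.
  move=> v0; rewrite big1 ?mulr_ge0 ?enorm_ge0// => i _.
  have /normr0_eq0-> : `|v 0 i| = 0; last by rewrite mulr0.
  by apply/le_anti; rewrite normr_ge0 (le_trans (normr_coord_le_enorm _ i)).
set a := enorm u in u0 *; set b := enorm v in v0 *.
(* With [a] and [b] the two norms, this sum equals [2ab (ab - <u, v>)], and [2ab > 0] because
   vanishing norms were treated above. *)
have : 0 <= \sum_(i < D) (b * u 0 i - a * v 0 i) ^+ 2.
  by apply: sumr_ge0 => i _; exact: sqr_ge0.
have -> : \sum_(i < D) (b * u 0 i - a * v 0 i) ^+ 2 =
    b ^+ 2 * \sum_(i < D) u 0 i ^+ 2 + a ^+ 2 * \sum_(i < D) v 0 i ^+ 2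
    - (2 * a * b) * \sum_(i < D) u 0 i * v 0 i.
  rewrite !mulr_sumr -big_split/= -sumrB; apply: eq_bigr => i _; ring.
rewrite -!sqr_enorm -/a -/b => h.
have ab0 : 0 < 2 * a * b by rewrite !mulr_gt0.
rewrite -(ler_pM2l ab0); lra.
Qed.

Lemma enormZ (R : realType) (D : nat) (k : R) (v : 'rV[R]_D) :
  enorm (k *: v) = `|k| * enorm v.
Proof.
rewrite /enorm -[`|k|]sqrtr_sqr -sqrtrM ?sqr_ge0// mulr_sumr; congr Num.sqrt.
by apply: eq_bigr => i _; rewrite mxE exprMn.
Qed.

(** * Calculus along segments and consequences of smoothness *)

Lemma is_derive_line (R : realType) (D : nat) (f : 'rV[R]_D -> R) x v (s : R) :
  (forall x, differentiable f x) ->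
  is_derive s 1 (fun r : R => f (x + r *: v))
    (\sum_(i < D) grad f (x + s *: v) 0 i * v 0 i).
Proof.
move=> df.
(* The difference quotient of the restriction to the line is that of the directional derivative at
   [x + s *: v]; linearity of the differential then expands [v] over the basis. *)
have E : (fun h => h^-1 *: (((fun r : R => f (x + r *: v)) \o shift s) (h *: 1)
             - f (x + s *: v))) =
    (fun h => h^-1 *: ((f \o shift (x + s *: v)) (h *: v) - f (x + s *: v))).
  apply/funext => h /=; congr (_ *: (f _ - _)).
  by rewrite [h *: 1]mulr1 scalerDl addrCA.
have dv : derivable f (x + s *: v) v by exact/diff_derivable.
split; first by rewrite /derivable E.
rewrite /derive E -/(derive f (x + s *: v) v); move: (x + s *: v) => a.
rewrite deriveE// {1}(row_sum_delta v) linear_sum; apply: eq_bigr => i _.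
by rewrite linearZ mxE deriveE//= mulrC.
Qed.

Lemma mean_value_line (R : realType) (D : nat) (f : 'rV[R]_D -> R) x y :
  (forall x, differentiable f x) ->
  exists2 s : R, 0 <= s <= 1 &
    f y - f x = \sum_(i < D) grad f (x + s *: (y - x)) 0 i * (y - x) 0 i.
Proof.
move=> df; pose phi r : R := f (x + r *: (y - x)).
have dphi s := is_derive_line x (y - x) s df.
have [|s c] := @MVT_segment R phi _ 0 1 ler01 (fun s _ => dphi s).
- apply: derivable_within_continuous => r _.
  exact: (@ex_derive _ _ _ _ _ _ _ (dphi r)).
rewrite /phi scale1r scale0r addr0 subr0 mulr1 [x + _]addrC subrK => fE.
by exists s.
Qed.

(** The mean value theorem produces the gradient at a point of the segment, hence at distance at
    most [enorm (y - x)] from [x]. This gives the constant [L] where integration along the segment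
    would give [L / 2]. *)
Lemma descent_lemma (R : realType) (D : nat) (f : 'rV[R]_D -> R) (L : R) x y :
  (forall x, differentiable f x) -> 0 <= L -> L_smooth L f ->
  f y <= f x + \sum_(i < D) grad f x 0 i * (y - x) 0 i
         + L * enorm (y - x) ^+ 2.
Proof.
move=> df L0 Lf; have [s /andP[s0 s1] fE] := mean_value_line x y df.
rewrite -lerBlDl opprD addrA fE -sumrB.
apply: (@le_trans _ _ (\sum_(i < D)
    (grad f (x + s *: (y - x)) - grad f x) 0 i * (y - x) 0 i)).
  by apply: ler_sum => i _; rewrite -mulrBl !mxE.
apply: (le_trans (cauchy_schwarz _ _)).
rewrite expr2 mulrA ler_wpM2r ?enorm_ge0// (le_trans (Lf _ _))//.
by rewrite addrC addKr enormZ ler_wpM2l// ger0_norm// ler_piMl// enorm_ge0.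
Qed.

(** A gradient step of length [1 / (2 L)] lowers [f] by at least [|grad f|^2 / (4 L)], and no
    decrease can exceed [f_sup - f_inf]. *)
Lemma bounded_smooth_grad_bounded (R : realType) (D : nat)
    (f : 'rV[R]_D -> R) (L f_inf f_sup : R) :
  (forall x, differentiable f x) -> 0 < L -> L_smooth L f ->
  (forall x, f_inf <= f x <= f_sup) ->
  forall x, enorm (grad f x) ^+ 2 <= 4 * L * (f_sup - f_inf).
Proof.
move=> df L0 Lf fb x; pose s : R := (2 * L)^-1.
have := descent_lemma x (x - s *: grad f x) df (ltW L0) Lf.
have -> : x - s *: grad f x - x = (- s) *: grad f x.
  by rewrite addrAC subrr add0r scaleNr.
rewrite enormZ exprMn real_normK ?num_real// sqrrN.
have -> : \sum_(i < D) grad f x 0 i * ((- s) *: grad f x) 0 i =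
    - s * enorm (grad f x) ^+ 2.
  rewrite sqr_enorm mulr_sumr; apply: eq_bigr => i _; rewrite !mxE; ring.
have /andP[_ ub] := fb x; have /andP[lb _] := fb (x - s *: grad f x).
set N := _ ^+ 2 => h.
have h2 : f_inf <= f_sup - s * N + L * (s ^+ 2 * N) by lra.
have -> : N = 4 * L * (s * N - L * (s ^+ 2 * N)).
  rewrite /s; field; exact: lt0r_neq0.
by rewrite ler_pM2l ?mulr_gt0//; lra.
Qed.

(** * Measurability of Lipschitz functions and of the scalings *)

(** [F] is the infimum over rational points [q] of [F q + C |z - q|_1], so each strict sublevel set
    is a countable union of sets described through the coordinates of [z] alone. *)
Lemma measurable_fun_lipschitz_row (d : measure_display) (T : measurableType d)
    (R : realType) (D : nat) (F : 'rV[R]_D -> R) (C : R) (z : T -> 'rV[R]_D) :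
  0 <= C -> (forall x y, F x - F y <= C * \sum_(i < D) `|x 0 i - y 0 i|) ->
  (forall i, measurable_fun setT (fun w => z w 0 i)) ->
  measurable_fun setT (fun w => F (z w)).
Proof.
move=> C0 FC mz.
apply: (measurability _ (RGenInftyO.measurableE R)) => //.
move=> _ [_ [a ->] <-]; rewrite setTI.
pose q2r (q : 'rV[rat]_D) : 'rV[R]_D := map_mx ratr q.
pose G (q : 'rV[rat]_D) w := F (q2r q) + C * \sum_(i < D) `|z w 0 i - q2r q 0 i|.
have -> : (fun w => F (z w)) @^-1` `]-oo, a[ = \bigcup_q (G q @^-1` `]-oo, a[).
  apply/seteqP; split => w /=; rewrite in_itv/=; last first.
    move=> [q _] /=; rewrite in_itv/=; apply: le_lt_trans.
    by rewrite /G -lerBlDl.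
  (* If [q] is within [e] of [z w] in every coordinate, [G q w] exceeds [F (z w)] by at most
     [2 C D e], which is less than [a - F (z w)]. The [+ 1] keeps the denominator positive when [C]
     or [D] is zero. *)
  move=> Fza; pose e := (a - F (z w)) / (2 * C * D%:R + 1).
  have CD : 0 < 2 * C * D%:R + 1 by rewrite ltr_wpDl ?mulr_ge0.
  have e0 : 0 < e by rewrite divr_gt0// subr_gt0.
  have /choice[r rE] : forall i, exists r : rat, `|z w 0 i - ratr r| < e.
    move=> i; have : z w 0 i - e < z w 0 i + e by lra.
    move=> /rat_in_itvoo[r]; rewrite in_itv/= => /andP[r1 r2].
    by exists r; rewrite ltr_norml; lra.
  exists (\row_i r i) => //=; rewrite in_itv/= /G.
  have SE : \sum_(i < D) `|z w 0 i - q2r (\row_i r i) 0 i| <= D%:R * e.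
    rewrite -[D in D%:R]card_ord mulr_natl -sumr_const.
    by apply: ler_sum => i _; rewrite !mxE ltW.
  have := FC (q2r (\row_i r i)) (z w).
  under eq_bigr do rewrite distrC; set S := \sum_(i < D) _ in SE *; move=> h.
  have CS : C * S <= C * (D%:R * e) by apply: ler_wpM2l.
  have : a - F (z w) = e * (2 * C * D%:R + 1).
    by rewrite /e divfK// gt_eqF.
  lra.
apply: countable_bigcupT_measurable; first exact: countableP.
move=> q; rewrite -[X in measurable X]setTI.
apply: (_ : measurable_fun setT (G q)) => //.
apply: measurable_funD => //; apply: measurable_funM => //.
apply: measurable_sum => i; apply: measurableT_comp => //.
exact: measurable_funB.
Qed.

Lemma measurable_fun_sqrt (R : realType) : measurable_fun setT (@Num.sqrt R).
Proof. by apply: continuous_measurable_fun => x; exact: sqrt_continuous. Qed.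

Lemma measurable_fun_inv_max (d : measure_display) (T : measurableType d)
    (R : realType) (eps : R) (v : T -> R) :
  0 < eps -> measurable_fun setT v ->
  measurable_fun setT (fun w => (Num.max (Num.sqrt (v w)) eps)^-1).
Proof.
move=> e0 mv.
have -> : (fun w => (Num.max (Num.sqrt (v w)) eps)^-1) =
    (fun w => powR (Num.max (Num.sqrt (v w)) eps) (-1)).
  by apply/funext => w; rewrite powR_inv1// le_max (ltW e0) orbT.
apply: (measurableT_comp (measurable_powR (-1))).
apply: measurable_maxr => //; exact: (measurableT_comp (@measurable_fun_sqrt R)).
Qed.

(** * Integrable real random variables and their expectations *)

Section real_integrals.
Context (d : measure_display) (T : measurableType d) (R : realType).
Variable P : probability T R.
Implicit Types X Y : T -> R.

Definition rintegrable X := P.-integrable setT (EFin \o X).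

Lemma rintegrable_measurable X : rintegrable X -> measurable_fun setT X.
Proof. by move=> /integrableP[/measurable_EFinP]. Qed.

Lemma rintegrable_dominated X Y : measurable_fun setT X -> rintegrable Y ->
  (forall w, `|X w| <= Y w) -> rintegrable X.
Proof.
move=> mX iY XY; apply: le_integrable iY => //; first exact/measurable_EFinP.
by move=> w _; rewrite lee_fin (le_trans (XY w))// ler_norm.
Qed.

Lemma rintegrable_cst (c : R) : rintegrable (fun=> c).
Proof. exact: finite_measure_integrable_cst. Qed.

Lemma rintegrable_bounded X (B : R) : measurable_fun setT X ->
  (forall w, `|X w| <= B) -> rintegrable X.
Proof.
by move=> mX; apply: rintegrable_dominated => //; exact: rintegrable_cst.
Qed.

Lemma rintegrableD X Y :
  rintegrable X -> rintegrable Y -> rintegrable (fun w => X w + Y w).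
Proof. exact: integrableD. Qed.

Lemma rintegrableB X Y :
  rintegrable X -> rintegrable Y -> rintegrable (fun w => X w - Y w).
Proof. exact: integrableB. Qed.

Lemma rintegrableZ (c : R) X :
  rintegrable X -> rintegrable (fun w => c * X w).
Proof. exact: integrableZl. Qed.

Lemma rintegrable_norm X : rintegrable X -> rintegrable (fun w => `|X w|).
Proof. exact: integrable_norm. Qed.

Lemma rintegrable_sum (I : Type) (s : seq I) (F : I -> T -> R) :
  (forall i, rintegrable (F i)) -> rintegrable (fun w => \sum_(i <- s) F i w).
Proof.
move=> iF; elim: s => [|i s IH].
  by under eq_fun do rewrite big_nil; exact: rintegrable_cst.
by under eq_fun do rewrite big_cons; exact: rintegrableD.
Qed.

Lemma rintegrableM_bounded (phi : T -> R) X (B : R) :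
  measurable_fun setT phi -> (forall w, `|phi w| <= B) -> rintegrable X ->
  rintegrable (fun w => phi w * X w).
Proof.
move=> mphi pB iX; apply: (rintegrable_dominated (Y := fun w => B * `|X w|)).
- by apply: measurable_funM => //; exact: rintegrable_measurable.
- exact/rintegrableZ/rintegrable_norm.
- by move=> w; rewrite normrM ler_wpM2r.
Qed.

Lemma Rexpect_cst (c : R) : \int[P]_w c = c.
Proof.
have P1 : fine (P setT) = 1 by rewrite probability_setT.
rewrite Rintegral_cst//; change (c * fine (P setT) = c).
by rewrite P1 mulr1.
Qed.

Lemma RexpectZ (c : R) X : rintegrable X ->
  \int[P]_w (c * X w) = c * \int[P]_w X w.
Proof. exact: RintegralZl. Qed.

Lemma RexpectD X Y : rintegrable X -> rintegrable Y ->
  \int[P]_w (X w + Y w) = \int[P]_w X w + \int[P]_w Y w.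
Proof. exact: RintegralD. Qed.

Lemma RexpectB X Y : rintegrable X -> rintegrable Y ->
  \int[P]_w (X w - Y w) = \int[P]_w X w - \int[P]_w Y w.
Proof. exact: RintegralB. Qed.

Lemma Rexpect_sum (I : Type) (s : seq I) (F : I -> T -> R) :
  (forall i, rintegrable (F i)) ->
  \int[P]_w (\sum_(i <- s) F i w) = \sum_(i <- s) \int[P]_w F i w.
Proof.
move=> iF; elim: s => [|i s IH].
  rewrite big_nil -[RHS]Rexpect_cst; apply: eq_Rintegral => w _.
  by rewrite big_nil.
rewrite big_cons -IH -RexpectD//; last exact: rintegrable_sum.
by apply: eq_Rintegral => w _; rewrite big_cons.
Qed.

Lemma le_Rexpect X Y : rintegrable X -> rintegrable Y ->
  (forall w, X w <= Y w) -> \int[P]_w X w <= \int[P]_w Y w.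
Proof. by move=> iX iY XY; apply: le_Rintegral. Qed.

Lemma RexpectE X : rintegrable X ->
  (\int[P]_w (X w)%:E)%E = (\int[P]_w X w)%:E.
Proof. by move=> iX; rewrite /Rintegral fineK//; exact: integrable_fin_num. Qed.

(* The binary expansion [phi = 1_(1/2 <= phi) / 2 + psi / 2] with
   [0 <= psi <= 1] halves the bound on [|E (phi Y)|] at each step. *)
Lemma Rexpect_unit_mul_bound (S : set (set T)) Y :
  <<s S >> `<=` measurable -> rintegrable Y ->
  (forall A, <<s S >> A -> \int[P]_(w in A) Y w = 0) ->
  forall (n : nat) (phi : T -> R),
    measurable_fun setT (phi : g_sigma_algebraType S -> R) ->
    (forall w, 0 <= phi w <= 1) ->
    `|\int[P]_w (phi w * Y w)| <= 2^-1 ^+ n * \int[P]_w `|Y w|.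
Proof.
move=> sS iY Y0.
have mT (phi : T -> R) : measurable_fun setT (phi : g_sigma_algebraType S -> R) ->
    measurable_fun setT phi.
  by move=> mphi _ B mB; apply: sS; apply: mphi.
elim=> [|n IH] phi mphi phi01.
  rewrite expr0 mul1r (le_trans (le_normr_Rintegral _ _))//.
    apply: (rintegrableM_bounded (B := 1)) => // [|w]; first exact: mT.
    by rewrite ger0_norm; case/andP: (phi01 w).
  apply: le_Rexpect.
  - apply: rintegrable_norm; apply: (rintegrableM_bounded (B := 1)) => // [|w].
      exact: mT.
    by rewrite ger0_norm; case/andP: (phi01 w).
  - exact: rintegrable_norm.
  - move=> w; rewrite normrM ler_piMl// ger0_norm; by case/andP: (phi01 w).
pose A := [set w | 2^-1 <= phi w].
have SA : <<s S >> A.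
  have -> : A = setT `&` phi @^-1` `[2^-1, +oo[.
    by rewrite setTI; apply/seteqP; split => w; rewrite /A/= in_itv/= andbT.
  exact: mphi.
pose psi w := 2 * phi w - \1_A w.
have psi01 w : 0 <= psi w <= 1.
  rewrite /psi indicE; have /andP[p0 p1] := phi01 w.
  case: (boolP (w \in A)) => [/set_mem h|/negP wA].
    by rewrite mulr1n; move: h; rewrite /A/=; lra.
  have h : phi w < 2^-1.
    by rewrite ltNge; apply/negP => h; apply: wA; exact: mem_set.
  by rewrite mulr0n; lra.
have mA : measurable_fun setT (\1_A : g_sigma_algebraType S -> R).
  exact: measurable_indic.
have mpsi : measurable_fun setT (psi : g_sigma_algebraType S -> R).
  by apply: measurable_funB => //; exact: measurable_funM.
have iA : rintegrable (fun w => \1_A w * Y w).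
  apply: (rintegrableM_bounded (B := 1)) => // [|w]; first exact: mT.
  by rewrite indicE; case: (_ \in _); rewrite ?normr1 ?normr0.
have ipsi : rintegrable (fun w => psi w * Y w).
  apply: (rintegrableM_bounded (B := 1)) => // [|w]; first exact: mT.
  by rewrite ger0_norm; case/andP: (psi01 w).
have -> : \int[P]_w (phi w * Y w) =
    \int[P]_w (2^-1 * (\1_A w * Y w) + 2^-1 * (psi w * Y w)).
  by apply: eq_Rintegral => w _; rewrite /psi; lra.
rewrite RexpectD; [|exact: rintegrableZ..].
rewrite !RexpectZ//.
have -> : \int[P]_w (\1_A w * Y w) = 0.
  rewrite -[RHS](Y0 A SA) [RHS]Rintegral_mkcond; apply: eq_Rintegral => w _.
  by rewrite patchE indicE; case: (_ \in _); rewrite ?mul1r ?mul0r.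
rewrite mulr0 add0r normrM ger0_norm// exprS -mulrA ler_wpM2l//.
exact: IH.
Qed.

(** An affine map sends [phi] into [[0, 1]], where the bounds by [2^-n] force the integral to
    vanish; the shift only adds a multiple of the integral of [Y] over the whole space, zero as
    well. This turns a conditional expectation given on events into one usable against bounded
    weights. *)
Lemma Rexpect_bounded_mul_eq0 (S : set (set T)) Y (phi : T -> R) (B : R) :
  <<s S >> `<=` measurable -> rintegrable Y ->
  (forall A, <<s S >> A -> \int[P]_(w in A) Y w = 0) ->
  measurable_fun setT (phi : g_sigma_algebraType S -> R) ->
  0 < B -> (forall w, `|phi w| <= B) ->
  \int[P]_w (phi w * Y w) = 0.
Proof.
move=> sS iY Y0 mphi B0 phiB.
have unit0 (psi : T -> R) :
    measurable_fun setT (psi : g_sigma_algebraType S -> R) ->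
    (forall w, 0 <= psi w <= 1) -> \int[P]_w (psi w * Y w) = 0.
  move=> mpsi psi01; apply/eqP; rewrite -normr_eq0 eq_le normr_ge0 andbT.
  have h n := Rexpect_unit_mul_bound sS iY Y0 n mpsi psi01.
  have u0 : (fun n => 2^-1 ^+ n * \int[P]_w `|Y w|) @ \oo --> (0 : R).
    rewrite -[X in _ --> X](mul0r (\int[P]_w `|Y w|)); apply: cvgMr_tmp.
    by apply: cvg_expr; rewrite ger0_norm// invf_lt1// ltr1n.
  rewrite -(cvg_lim _ u0)//; apply: limr_ge; first by apply/cvg_ex; exists 0.
  exact: nearW.
pose psi w := (2 * B)^-1 * (phi w + B).
have mpsi : measurable_fun setT (psi : g_sigma_algebraType S -> R).
  by apply: measurable_funM => //; exact: measurable_funD.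
have psi01 w : 0 <= psi w <= 1.
  rewrite /psi; have := phiB w; rewrite ler_norml => /andP[h1 h2].
  have B2 : 0 < 2 * B by rewrite mulr_gt0.
  rewrite mulrC ler_pdivrMr// mul1r divr_ge0 ?(ltW B2)//=; lra.
have mpsiT : measurable_fun setT (psi : T -> R).
  by move=> _ C mC; apply: sS; apply: mpsi.
have -> : \int[P]_w (phi w * Y w) =
    \int[P]_w (2 * B * (psi w * Y w) - B * Y w).
  apply: eq_Rintegral => w _; rewrite /psi; field; exact: lt0r_neq0.
have i1 : rintegrable (fun w => psi w * Y w).
  apply: (rintegrableM_bounded (B := 1)) => // w.
  by rewrite ger0_norm; case/andP: (psi01 w).
rewrite RexpectB; [|exact: rintegrableZ..].
rewrite !RexpectZ// unit0// (Y0 setT) ?mulr0 ?subr0//.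
exact: (@measurableT _ (g_sigma_algebraType S)).
Qed.

End real_integrals.

(** * ADOPT along one fixed sequence of gradients *)

Section adopt_path.
Context (R : realType) (D : nat).
Variables (alpha : nat -> R) (b1 b2 eps : R) (th0 : 'rV[R]_D).
Variable g : nat -> 'rV[R]_D.

Let state := adopt_state alpha b1 b2 eps th0 g.
Local Notation theta := (adopt_theta alpha b1 b2 eps th0 g).

Definition adopt_v t := (state t).1.2.

(* The third component of the state at [t] is [m_{t+1}]. *)
Definition adopt_mS t := (state t).2.

Definition adopt_scale t i := Num.max (Num.sqrt (adopt_v t 0 i)) eps.

Lemma adopt_thetaS t : theta t.+1 = theta t - alpha t.+1 *: adopt_mS t.
Proof.
by rewrite /adopt_theta /adopt_mS /state/=; case: adopt_state => [[]].
Qed.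

Lemma adopt_v0 i : adopt_v 0 0 i = g 0 0 i ^+ 2.
Proof. by rewrite mxE. Qed.

Lemma adopt_vS t i :
  adopt_v t.+1 0 i = b2 * adopt_v t 0 i + (1 - b2) * g t.+1 0 i ^+ 2.
Proof.
rewrite /adopt_v /state/=; case: adopt_state => [[th v] m] /=.
by rewrite mxE expr2.
Qed.

Lemma adopt_mS0 i : adopt_mS 0 0 i = g 1 0 i / adopt_scale 0 i.
Proof. by rewrite mxE. Qed.

Lemma adopt_mSS t i : adopt_mS t.+1 0 i =
  b1 * adopt_mS t 0 i + (1 - b1) * (g t.+2 0 i / adopt_scale t.+1 i).
Proof.
rewrite /adopt_scale /adopt_mS /adopt_v /state/=.
by case: adopt_state => [[th v] m] /=; rewrite mxE.
Qed.

(** The discounted sum of [b1^j * alpha (t + j)] over [j < k]: the total step along a momentum that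
    decays by [b1] at each of [k] updates. *)
Fixpoint lookahead (k t : nat) : R :=
  if k is k'.+1 then alpha t + b1 * lookahead k' t.+1 else 0.

(* For [k = oo] this is the usual auxiliary sequence of momentum methods. *)
Definition adopt_zeta k t := theta t - lookahead k t.+1 *: adopt_mS t.

(** The fresh direction entering [m_{t+2}]; its scale uses [v_{t+1}], which is known before
    [g_{t+2}]. *)
Definition adopt_h t := \row_i (g t.+2 0 i / adopt_scale t.+1 i).

(** The old momentum inside [m_{t+2}] is already accounted for by the longer lookahead, so it
    cancels and only the fresh part remains. *)
Lemma adopt_zetaS k t :
  adopt_zeta k t.+1 =
  adopt_zeta k.+1 t - ((1 - b1) * lookahead k t.+2) *: adopt_h t.
Proof.
apply/rowP => i; rewrite /adopt_zeta adopt_thetaS !mxE adopt_mSS /=; ring.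
Qed.

(** This gap is of the order of one step size, so exchanging gradients between the two points inside
    a term already multiplied by a step size costs only a quadratic error. *)
Lemma adopt_zeta_theta k t :
  adopt_zeta k.+1 t - theta t.+1 = - (b1 * lookahead k t.+2) *: adopt_mS t.
Proof. apply/rowP => i; rewrite /adopt_zeta adopt_thetaS !mxE /=; ring. Qed.

Definition precond_sqgrad (f : 'rV[R]_D -> R) t :=
  \sum_(i < D) grad f (theta t) 0 i ^+ 2 / adopt_scale t i.

Hypothesis eps0 : 0 < eps.

Lemma adopt_scale_ge t i : eps <= adopt_scale t i.
Proof. by rewrite le_max lexx orbT. Qed.

Lemma adopt_scale_gt0 t i : 0 < adopt_scale t i.
Proof. exact: lt_le_trans (adopt_scale_ge t i). Qed.

Lemma adopt_scaleV_le t i : (adopt_scale t i)^-1 <= eps^-1.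
Proof. by rewrite lef_pV2 ?posrE ?adopt_scale_ge// adopt_scale_gt0. Qed.

Lemma adopt_scaleV_ge0 t i : 0 <= (adopt_scale t i)^-1.
Proof. by rewrite invr_ge0 ltW// adopt_scale_gt0. Qed.

Lemma enorm_div_scale t (u : 'rV[R]_D) :
  enorm (\row_i (u 0 i / adopt_scale t i)) <= enorm u / eps.
Proof.
have u0 : 0 <= enorm u / eps by rewrite divr_ge0 ?enorm_ge0// ltW.
rewrite -[leRHS](ger0_norm u0) -[leRHS]sqrtr_sqr ler_wsqrtr//.
rewrite exprMn sqr_enorm mulr_suml; apply: ler_sum => i _.
rewrite mxE exprMn ler_wpM2l ?sqr_ge0// ler_sqr ?nnegrE ?adopt_scaleV_ge0//.
  exact: adopt_scaleV_le.
by rewrite invr_ge0 ltW.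
Qed.

(** The descent lemma is applied to the move of [adopt_zetaS], with [g_{t+2}] split into
    [grad f (theta t.+1)] and noise. The noise is weighted by quantities depending on
    [g_0, ..., g_{t+1}] only, so that it can later average out. In the other part, replacing the
    gradient at [zeta] by the one at [theta t.+1] yields [precond_sqgrad] up to a term quadratic in
    the lookahead. *)
Lemma adopt_one_step (f : 'rV[R]_D -> R) (L M : R) k t :
  (forall x, differentiable f x) -> 0 < L -> L_smooth L f ->
  (forall x, enorm (grad f x) <= M) -> 0 <= b1 <= 1 ->
  0 <= lookahead k t.+2 ->
  f (adopt_zeta k t.+1)
    + (1 - b1) * lookahead k t.+2 * precond_sqgrad f t.+1 <=
  f (adopt_zeta k.+1 t)
  - (1 - b1) * lookahead k t.+2 *
    (\sum_(i < D) grad f (adopt_zeta k.+1 t) 0 i / adopt_scale t.+1 i *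
       (g t.+2 0 i - grad f (theta t.+1) 0 i))
  + (1 - b1) * lookahead k t.+2 * lookahead k t.+2 * (L * M / eps) *
    (1 + \sum_(i < D) adopt_mS t 0 i ^+ 2)
  + ((1 - b1) * lookahead k t.+2) ^+ 2 * (L / eps ^+ 2) *
    \sum_(i < D) g t.+2 0 i ^+ 2.
Proof.
move=> df L0 Lf gM /andP[b0 b1le].
set e := lookahead k t.+2; set z := adopt_zeta k.+1 t => e0.
set c := (1 - b1) * e.
have c0 : 0 <= c by rewrite mulr_ge0// subr_ge0.
have M0 : 0 <= M by apply: le_trans (gM 0); exact: enorm_ge0.
have := descent_lemma z (adopt_zeta k t.+1) df (ltW L0) Lf.
rewrite adopt_zetaS -/e -/c -/z.
have -> : z - c *: adopt_h t - z = (- c) *: adopt_h t.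
  by rewrite addrAC subrr add0r scaleNr.
rewrite enormZ exprMn real_normK ?num_real// sqrrN => h.
have h1 : L * (c ^+ 2 * enorm (adopt_h t) ^+ 2) <=
    c ^+ 2 * (L / eps ^+ 2) * \sum_(i < D) g t.+2 0 i ^+ 2.
  rewrite -[leRHS]mulrA mulrCA ler_wpM2l ?sqr_ge0// -mulrA.
  apply: ler_wpM2l; first exact: ltW.
  rewrite -sqr_enorm mulrC -exprVn -exprMn ler_sqr ?nnegrE ?enorm_ge0//.
    exact: enorm_div_scale.
  by rewrite divr_ge0 ?enorm_ge0// ltW.
(* This is [adopt_h t] with the fresh gradient replaced by its conditional mean. *)
set q := \row_i (grad f (theta t.+1) 0 i / adopt_scale t.+1 i).
have h2 : precond_sqgrad f t.+1 -
    \sum_(i < D) grad f z 0 i * q 0 i <=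
    e * (L * M / eps) * (1 + \sum_(i < D) adopt_mS t 0 i ^+ 2).
  have -> : precond_sqgrad f t.+1 - \sum_(i < D) grad f z 0 i * q 0 i =
      \sum_(i < D) (grad f (theta t.+1) - grad f z) 0 i * q 0 i.
    rewrite /precond_sqgrad -sumrB; apply: eq_bigr => i _; rewrite !mxE; ring.
  apply: (le_trans (cauchy_schwarz _ _)).
  have n1 : enorm (grad f (theta t.+1) - grad f z) <=
      L * (e * enorm (adopt_mS t)).
    apply: (le_trans (Lf _ _)); apply: ler_wpM2l; first exact: ltW.
    rewrite -opprB -scaleN1r.
    rewrite adopt_zeta_theta scalerA mulN1r opprK enormZ ger0_norm ?mulr_ge0//.
    by rewrite ler_wpM2r ?enorm_ge0// ler_piMl.
  have n2 : enorm q <= M / eps.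
    apply: (le_trans (enorm_div_scale _ _)).
    by apply: ler_wpM2r => //; rewrite invr_ge0 ltW.
  apply: (le_trans (ler_pM (enorm_ge0 _) (enorm_ge0 _) n1 n2)).
  have -> : L * (e * enorm (adopt_mS t)) * (M / eps) =
      e * (L * M / eps) * enorm (adopt_mS t) by ring.
  rewrite -sqr_enorm; apply: ler_wpM2l.
    by apply: mulr_ge0 => //; rewrite divr_ge0 ?mulr_ge0// ltW.
  (* [a <= 1 + a^2] trades the norm for its square, whose expectation is controlled. *)
  have := enorm_ge0 (adopt_mS t); set a := enorm _ => a0; nra.
have -> : \sum_(i < D) grad f z 0 i / adopt_scale t.+1 i *
      (g t.+2 0 i - grad f (theta t.+1) 0 i) =
    \sum_(i < D) grad f z 0 i * adopt_h t 0 i - \sum_(i < D) grad f z 0 i * q 0 i.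
  rewrite -sumrB; apply: eq_bigr => i _; rewrite !mxE; ring.
have h3 : \sum_(i < D) grad f z 0 i * ((- c) *: adopt_h t) 0 i =
    - c * \sum_(i < D) grad f z 0 i * adopt_h t 0 i.
  rewrite mulr_sumr; apply: eq_bigr => i _; rewrite !mxE; ring.
rewrite {}h3 in h; move: (ler_wpM2l c0 h2) => {}h2; lra.
Qed.

End adopt_path.

(** * Measurability of the iterates, and of [f] and its gradient along them *)

(** The space [U] is arbitrary so that the result serves both the ambient sigma-algebra and the one
    generated by past gradients. The range reaches [n.+1] because the state at [n] contains
    [m_{n+1}], hence [g_{n+1}]. *)
Lemma measurable_adopt_state (d : measure_display) (U : measurableType d)
    (R : realType) (D : nat) (alpha : nat -> R) (b1 b2 eps : R)
    (th0 : 'rV[R]_D) (g : nat -> U -> 'rV[R]_D) (n : nat) :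
  0 < eps ->
  (forall s i, (s <= n.+1)%N -> measurable_fun setT (fun w => g s w 0 i)) ->
  forall t, (t <= n)%N -> forall i,
  [/\ measurable_fun setT
        (fun w => adopt_theta alpha b1 b2 eps th0 (fun s => g s w) t 0 i),
      measurable_fun setT
        (fun w => adopt_v alpha b1 b2 eps th0 (fun s => g s w) t 0 i) &
      measurable_fun setT
        (fun w => adopt_mS alpha b1 b2 eps th0 (fun s => g s w) t 0 i)].
Proof.
move=> e0 mg; elim=> [|t IH] tn i.
  have mv : measurable_fun setT
      (fun w => adopt_v alpha b1 b2 eps th0 (fun s => g s w) 0 0 i).
    by under eq_fun do rewrite adopt_v0; apply: measurable_funX; exact: mg.
  split => //; under eq_fun do rewrite adopt_mS0.
  apply: measurable_funM; first by apply: mg.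
  exact: measurable_fun_inv_max.
have [mth mv mm] := IH (ltnW tn) i.
have mvS : measurable_fun setT
    (fun w => adopt_v alpha b1 b2 eps th0 (fun s => g s w) t.+1 0 i).
  under eq_fun do rewrite adopt_vS.
  apply: measurable_funD; apply: measurable_funM => //.
  by apply: measurable_funX; apply: mg; rewrite ltnW.
split => //.
  under eq_fun do rewrite adopt_thetaS !mxE.
  by apply: measurable_funB => //; exact: measurable_funM.
under eq_fun do rewrite adopt_mSS.
apply: measurable_funD; apply: measurable_funM => //.
apply: measurable_funM; first by apply: mg.
exact: measurable_fun_inv_max.
Qed.

Lemma measurable_grad (d : measure_display) (U : measurableType d)
    (R : realType) (D : nat) (f : 'rV[R]_D -> R) (L : R) (z : U -> 'rV[R]_D) i :
  0 <= L -> L_smooth L f ->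
  (forall j, measurable_fun setT (fun w => z w 0 j)) ->
  measurable_fun setT (fun w => grad f (z w) 0 i).
Proof.
move=> L0 Lf.
apply: (measurable_fun_lipschitz_row (F := fun x => grad f x 0 i) L0).
move=> x y; have -> : grad f x 0 i - grad f y 0 i = (grad f x - grad f y) 0 i.
  by rewrite !mxE.
apply: (le_trans (ler_norm _)); apply: (le_trans (normr_coord_le_enorm _ _)).
apply: (le_trans (Lf _ _)); apply: ler_wpM2l => //.
apply: (le_trans (enorm_le_sum _)).
by apply: ler_sum => j _; rewrite !mxE.
Qed.

(** By the mean value theorem, a bounded gradient makes [f] Lipschitz. *)
Lemma measurable_bounded_grad (d : measure_display) (U : measurableType d)
    (R : realType) (D : nat) (f : 'rV[R]_D -> R) (M : R) (z : U -> 'rV[R]_D) :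
  (forall x, differentiable f x) -> (forall x, enorm (grad f x) <= M) ->
  (forall j, measurable_fun setT (fun w => z w 0 j)) ->
  measurable_fun setT (fun w => f (z w)).
Proof.
move=> df gM; have M0 : 0 <= M by apply: le_trans (gM 0); exact: enorm_ge0.
apply: (measurable_fun_lipschitz_row M0) => x y.
have [s _ ->] := mean_value_line y x df.
apply: (le_trans (cauchy_schwarz _ _)); apply: ler_pM; rewrite ?enorm_ge0//.
apply: (le_trans (enorm_le_sum _)).
by apply: ler_sum => j _; rewrite !mxE.
Qed.

(** * Moment bounds and expected descent along the random iterates *)

Section adopt_expectations.
Context (R : realType) (D : nat) (d : measure_display) (Omega : measurableType d).
Variables (P : probability Omega R) (f : 'rV[R]_D -> R).
Variables (L M f_inf f_sup b1 b2 eps G : R) (alpha : nat -> R).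
Variables (th0 : 'rV[R]_D) (g : nat -> Omega -> 'rV[R]_D).
Hypothesis df : forall x, differentiable f x.
Hypothesis L0 : 0 < L.
Hypothesis Lf : L_smooth L f.
Hypothesis fb : forall x, f_inf <= f x <= f_sup.
Hypothesis gM : forall x, enorm (grad f x) <= M.
Hypothesis b101 : 0 <= b1 < 1.
Hypothesis b201 : 0 <= b2 < 1.
Hypothesis eps0 : 0 < eps.
Hypothesis mg : forall t i, measurable_fun setT (fun w => g t w 0 i).
Hypothesis Eg2 : forall t, (\int[P]_w (enorm (g t w) ^+ 2)%:E <= (G ^+ 2)%:E)%E.

Let path w s := g s w.
Let theta t w := adopt_theta alpha b1 b2 eps th0 (path w) t.
Let v t w := adopt_v alpha b1 b2 eps th0 (path w) t.
Let mS t w := adopt_mS alpha b1 b2 eps th0 (path w) t.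
Let scale t w := adopt_scale alpha b1 b2 eps th0 (path w) t.
Let zeta k t w := adopt_zeta alpha b1 b2 eps th0 (path w) k t.
Let X t w := precond_sqgrad alpha b1 b2 eps th0 (path w) f t.
Let e := lookahead alpha b1.

Hypothesis condE : forall t i (A : set Omega), past_sigma g t.+1 A ->
  (\int[P]_(w in A) (g t.+1 w 0 i)%:E =
   \int[P]_(w in A) (grad f (theta t w) 0 i)%:E)%E.

Let M0 : 0 <= M. Proof. by apply: le_trans (gM 0); exact: enorm_ge0. Qed.

Let sumsq_measurable t :
  measurable_fun setT (fun w => \sum_(i < D) g t w 0 i ^+ 2).
Proof. by apply: measurable_sum => i; exact: measurable_funX. Qed.

Lemma rintegrable_sumsq t : rintegrable P (fun w => \sum_(i < D) g t w 0 i ^+ 2).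
Proof.
apply/integrableP; split; first exact/measurable_EFinP.
apply: (@le_lt_trans _ _ (G ^+ 2)%:E); last exact: ltry.
apply: le_trans (Eg2 t); rewrite le_eqVlt; apply/orP; left; apply/eqP.
apply: eq_integral => w _ /=; rewrite sqr_enorm ger0_norm// sumr_ge0// => i _.
exact: sqr_ge0.
Qed.

Lemma Rexpect_sumsq t : \int[P]_w (\sum_(i < D) g t w 0 i ^+ 2) <= G ^+ 2.
Proof.
rewrite -lee_fin -RexpectE; last exact: rintegrable_sumsq.
by apply: le_trans (Eg2 t); under eq_integral do rewrite -sqr_enorm.
Qed.

Lemma rintegrable_sq t i : rintegrable P (fun w => g t w 0 i ^+ 2).
Proof.
apply: rintegrable_dominated (rintegrable_sumsq t) _.
  exact: measurable_funX.
move=> w; rewrite ger0_norm ?sqr_ge0// (bigD1 i)//= lerDl sumr_ge0// => j _.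
exact: sqr_ge0.
Qed.

Lemma rintegrable_g t i : rintegrable P (fun w => g t w 0 i).
Proof.
apply: (rintegrable_dominated (Y := fun w => 1 + g t w 0 i ^+ 2)) => //.
  by apply: rintegrableD; [exact: rintegrable_cst|exact: rintegrable_sq].
move=> w; rewrite -[_ ^+ 2]real_normK ?num_real//.
by have := normr_ge0 (g t w 0 i); set a := `|_| => a0; nra.
Qed.

Let mtheta t i : measurable_fun setT (fun w => theta t w 0 i).
Proof. by have [] := @measurable_adopt_state _ _ _ _ alpha b1 b2 _ th0 _ t eps0
  (fun s i _ => mg s i) t (leqnn t) i. Qed.

Let mv t i : measurable_fun setT (fun w => v t w 0 i).
Proof. by have [] := @measurable_adopt_state _ _ _ _ alpha b1 b2 _ th0 _ t eps0
  (fun s i _ => mg s i) t (leqnn t) i. Qed.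

Let mmS t i : measurable_fun setT (fun w => mS t w 0 i).
Proof. by have [] := @measurable_adopt_state _ _ _ _ alpha b1 b2 _ th0 _ t eps0
  (fun s i _ => mg s i) t (leqnn t) i. Qed.

Let mzeta k t i : measurable_fun setT (fun w => zeta k t w 0 i).
Proof.
rewrite /zeta /adopt_zeta; under eq_fun do rewrite !mxE.
apply: measurable_funB; first exact: mtheta.
by apply: measurable_funM => //; exact: mmS.
Qed.

Lemma rintegrable_f_zeta k t : rintegrable P (fun w => f (zeta k t w)).
Proof.
apply: (@rintegrable_bounded _ _ _ _ _ (`|f_inf| + `|f_sup|)).
  exact: (measurable_bounded_grad df gM).
move=> w; have /andP[h1 h2] := fb (zeta k t w).
rewrite ler_norml; have := ler_norm f_sup; have := ler_norm (- f_inf).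
by rewrite normrN; have := normr_ge0 f_sup; have := normr_ge0 f_inf; lra.
Qed.

Lemma rintegrable_grad_theta t i :
  rintegrable P (fun w => grad f (theta t w) 0 i).
Proof.
apply: (@rintegrable_bounded _ _ _ _ _ M).
  by apply: measurable_grad (ltW L0) Lf _ => j; exact: mtheta.
by move=> w; apply: (le_trans (normr_coord_le_enorm _ _)).
Qed.

Lemma rintegrable_precond t : rintegrable P (X t).
Proof.
apply: rintegrable_sum => i.
apply: (@rintegrable_bounded _ _ _ _ _ (M ^+ 2 / eps)).
  apply: measurable_funM; last by apply: measurable_fun_inv_max => //; exact: mv.
  apply: measurable_funX.
  by apply: measurable_grad (ltW L0) Lf _ => j; exact: mtheta.
move=> w; rewrite ger0_norm; last first.
  by apply: mulr_ge0; [exact: sqr_ge0|exact: adopt_scaleV_ge0].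
apply: ler_pM; [exact: sqr_ge0|exact: adopt_scaleV_ge0| |exact: adopt_scaleV_le].
rewrite -real_normK ?num_real// ler_sqr ?nnegrE//.
exact: (le_trans (normr_coord_le_enorm _ _)).
Qed.

(** Convexity of the square, with the exact gap [c (1 - c) (x - y)^2]. *)
Let sq_mix (c x y : R) : 0 <= c < 1 ->
  (c * x + (1 - c) * y) ^+ 2 <= c * x ^+ 2 + (1 - c) * y ^+ 2.
Proof.
move=> /andP[c0 c1]; rewrite -subr_ge0.
have -> : c * x ^+ 2 + (1 - c) * y ^+ 2 - (c * x + (1 - c) * y) ^+ 2 =
  c * (1 - c) * (x - y) ^+ 2 by ring.
apply: mulr_ge0; last exact: sqr_ge0.
by apply: mulr_ge0 => //; rewrite subr_ge0 ltW.
Qed.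

Let h2_le t w i :
  (g t.+1 w 0 i / scale t w i) ^+ 2 <= g t.+1 w 0 i ^+ 2 / eps ^+ 2.
Proof.
rewrite exprMn ler_wpM2l ?sqr_ge0// -exprVn ler_sqr ?nnegrE ?adopt_scaleV_ge0//.
  exact: adopt_scaleV_le.
by rewrite invr_ge0 ltW.
Qed.

(** The momentum is a convex combination of normalised gradients, each of second moment at most
    [G^2 / eps^2]; convexity of the square carries this bound through the recursion. *)
Lemma Rexpect_mS2 t : rintegrable P (fun w => \sum_(i < D) mS t w 0 i ^+ 2) /\
  \int[P]_w (\sum_(i < D) mS t w 0 i ^+ 2) <= G ^+ 2 / eps ^+ 2.
Proof.
have mm t' : measurable_fun setT (fun w => \sum_(i < D) mS t' w 0 i ^+ 2).
  by apply: measurable_sum => i; apply: measurable_funX; exact: mmS.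
have m0 t' w : 0 <= \sum_(i < D) mS t' w 0 i ^+ 2.
  by apply: sumr_ge0 => i _; exact: sqr_ge0.
have eV : 0 <= eps ^- 2 by rewrite invr_ge0 sqr_ge0.
elim: t => [|t [IH1 IH2]].
  have le0 w : \sum_(i < D) mS 0 w 0 i ^+ 2 <=
      eps ^- 2 * \sum_(i < D) g 1 w 0 i ^+ 2.
    rewrite mulr_sumr; apply: ler_sum => i _.
    by rewrite /mS adopt_mS0 [leRHS]mulrC; exact: h2_le.
  have i0 := rintegrableZ (eps ^- 2) (rintegrable_sumsq 1).
  have i1 : rintegrable P (fun w => \sum_(i < D) mS 0 w 0 i ^+ 2).
    by apply: rintegrable_dominated (mm 0) i0 _ => w; rewrite ger0_norm.
  split => //; apply: (le_trans (le_Rexpect i1 i0 le0)).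
  rewrite RexpectZ; last exact: rintegrable_sumsq.
  by rewrite mulrC ler_wpM2r// Rexpect_sumsq.
have leS w : \sum_(i < D) mS t.+1 w 0 i ^+ 2 <=
    b1 * (\sum_(i < D) mS t w 0 i ^+ 2) +
    (1 - b1) * (eps ^- 2 * \sum_(i < D) g t.+2 w 0 i ^+ 2).
  rewrite !mulr_sumr -big_split/=; apply: ler_sum => i _.
  rewrite /mS adopt_mSS; apply: (le_trans (sq_mix _ _ b101)).
  rewrite lerD2l; apply: ler_wpM2l.
    by case/andP: b101 => _ h; rewrite subr_ge0 ltW.
  by rewrite [leRHS]mulrC; exact: h2_le.
have i0 := rintegrableZ (eps ^- 2) (rintegrable_sumsq t.+2).
have i2 := rintegrableD (rintegrableZ b1 IH1) (rintegrableZ (1 - b1) i0).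
have i1 : rintegrable P (fun w => \sum_(i < D) mS t.+1 w 0 i ^+ 2).
  by apply: rintegrable_dominated (mm _) i2 _ => w; rewrite ger0_norm.
split => //; apply: (le_trans (le_Rexpect i1 i2 leS)).
rewrite RexpectD; [|exact: rintegrableZ..].
rewrite !RexpectZ//; last exact: rintegrable_sumsq.
have h3 : eps ^- 2 * \int[P]_w (\sum_(i < D) g t.+2 w 0 i ^+ 2) <=
    G ^+ 2 / eps ^+ 2.
  by rewrite mulrC ler_wpM2r// Rexpect_sumsq.
case/andP: b101 => b0 b1lt.
have h4 := ler_wpM2l b0 IH2.
have b1' : 0 <= 1 - b1 by rewrite subr_ge0 ltW.
have := ler_wpM2l b1' h3; lra.
Qed.

(** Here too a convex combination, now of squared gradients, keeps the bound from growing with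
    [t]. *)
Lemma Rexpect_v t : [/\ forall w i, 0 <= v t w 0 i,
  rintegrable P (fun w => \sum_(i < D) v t w 0 i) &
  \int[P]_w (\sum_(i < D) v t w 0 i) <= G ^+ 2].
Proof.
case/andP: b201 => b0 b2lt; have b2' : 0 <= 1 - b2 by rewrite subr_ge0 ltW.
elim: t => [|t [IH0 IH1 IH2]].
  have vE w i : v 0 w 0 i = g 0 w 0 i ^+ 2 by rewrite /v adopt_v0.
  split => [w i||]; first by rewrite vE sqr_ge0.
    by under eq_fun do under eq_bigr do rewrite vE; exact: rintegrable_sumsq.
  apply: le_trans (Rexpect_sumsq 0); rewrite le_eqVlt; apply/orP; left; apply/eqP.
  by apply: eq_Rintegral => w _; apply: eq_bigr => i _; exact: vE.
have vE w : \sum_(i < D) v t.+1 w 0 i =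
    b2 * (\sum_(i < D) v t w 0 i) + (1 - b2) * \sum_(i < D) g t.+1 w 0 i ^+ 2.
  rewrite !mulr_sumr -big_split/=; apply: eq_bigr => i _.
  by rewrite /v adopt_vS.
have i1 := rintegrableZ b2 IH1.
have i2 := rintegrableZ (1 - b2) (rintegrable_sumsq t.+1).
split => [w i||].
- by rewrite /v adopt_vS addr_ge0// mulr_ge0 ?sqr_ge0//; exact: IH0.
- by under eq_fun do rewrite vE; exact: rintegrableD.
have -> : \int[P]_w (\sum_(i < D) v t.+1 w 0 i) =
    \int[P]_w (b2 * (\sum_(i < D) v t w 0 i) +
               (1 - b2) * \sum_(i < D) g t.+1 w 0 i ^+ 2).
  by apply: eq_Rintegral => w _; exact: vE.
rewrite RexpectD// !RexpectZ//; last exact: rintegrable_sumsq.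
have := ler_wpM2l b0 IH2; have := ler_wpM2l b2' (Rexpect_sumsq t.+1); lra.
Qed.

Lemma past_sigma_measurable t : past_sigma g t `<=` measurable.
Proof.
apply: smallest_sub; first exact: sigma_algebra_measurable.
move=> _ [s [i [B [_ [mB ->]]]]].
by rewrite -[X in measurable X]setTI; exact: mg.
Qed.

(** The generators of [past_sigma], named so that functions of the past can be typed over
    [g_sigma_algebraType]. *)
Let gen t : set (set Omega) := [set A | exists (s : nat) (i : 'I_D) (B : set R),
  (s < t)%N /\ measurable B /\ A = (fun w => g s w 0 i) @^-1` B].

Let measurable_past t s i : (s < t)%N ->
  measurable_fun setT ((fun w => g s w 0 i) : g_sigma_algebraType (gen t) -> R).
Proof.
move=> st _ B mB; apply: sub_sigma_algebra; exists s, i, B.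
by rewrite setTI.
Qed.

(** The weight is bounded and a function of [g_0, ..., g_{t+1}], while the noise integrates to zero
    over every event of that past. The delayed scale is essential: [scale t.+1] does not see
    [g_{t+2}]. *)
Lemma Rexpect_martingale_term k t i :
  \int[P]_w (grad f (zeta k.+1 t w) 0 i / scale t.+1 w i *
             (g t.+2 w 0 i - grad f (theta t.+1 w) 0 i)) = 0.
Proof.
have iY := rintegrableB (rintegrable_g t.+2 i) (rintegrable_grad_theta t.+1 i).
apply: (@Rexpect_bounded_mul_eq0 _ _ _ P (gen t.+2) _
  (* The weight is bounded by [M / eps]; the [+ 1] makes the bound strictly positive even if
     [M = 0]. *)
  (fun w => grad f (zeta k.+1 t w) 0 i / scale t.+1 w i) (M / eps + 1)) => //.
- exact: (@past_sigma_measurable t.+2).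
- move=> A sA; have mA := past_sigma_measurable sA.
  have iS Z : rintegrable P Z -> P.-integrable A (EFin \o Z).
    by move=> iZ; apply: (integrableS measurableT mA _ iZ).
  rewrite RintegralB//; first by rewrite /Rintegral condE// subrr.
    exact/iS/rintegrable_g.
  exact/iS/rintegrable_grad_theta.
- pose U := g_sigma_algebraType (gen t.+2).
  have mU := @measurable_adopt_state _ U R D alpha b1 b2 eps th0 g t eps0
    (fun s i st => @measurable_past t.+2 s i st) t (leqnn t).
  apply: measurable_funM.
    apply: (measurable_grad (z := zeta k.+1 t : U -> _) _ (ltW L0) Lf) => j.
    rewrite /zeta /adopt_zeta; under eq_fun do rewrite !mxE.
    have [m1 _ m3] := mU j.
    by apply: measurable_funB => //; exact: measurable_funM.
  apply: (measurable_fun_inv_max (T := U)) => //.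
  under eq_fun do rewrite adopt_vS.
  apply: measurable_funD; apply: measurable_funM => //; first by have [] := mU i.
  by apply: measurable_funX; exact: (@measurable_past t.+2).
- by apply: ltr_wpDl => //; rewrite divr_ge0// ltW.
- move=> w; apply: (@le_trans _ _ (M / eps)); last by rewrite lerDl.
  rewrite normrM; apply: ler_pM => //.
    exact: (le_trans (normr_coord_le_enorm _ _)).
  by rewrite ger0_norm ?adopt_scaleV_ge0// adopt_scaleV_le.
Qed.

(** Integrating [adopt_one_step] removes the noise and turns the second moments of momentum and
    gradient into constants, leaving two errors quadratic in [e k t.+2] against a gain linear in
    it. *)
Lemma Rexpect_one_step k t : 0 <= e k t.+2 ->
  \int[P]_w f (zeta k t.+1 w) + (1 - b1) * e k t.+2 * \int[P]_w X t.+1 w <=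
  \int[P]_w f (zeta k.+1 t w)
  + (1 - b1) * e k t.+2 * e k t.+2 * (L * M / eps) * (1 + G ^+ 2 / eps ^+ 2)
  + ((1 - b1) * e k t.+2) ^+ 2 * (L / eps ^+ 2) * G ^+ 2.
Proof.
move=> e0; set ek := e k t.+2 in e0 *; case/andP: (b101) => b0 b1lt.
have c0 : 0 <= 1 - b1 by rewrite subr_ge0 ltW.
set c := (1 - b1) * ek.
set C1 := c * ek * (L * M / eps); set C2 := c ^+ 2 * (L / eps ^+ 2).
have C10 : 0 <= C1.
  rewrite /C1 /c; apply: mulr_ge0; first by do 2 apply: mulr_ge0 => //.
  by apply: divr_ge0; [apply: mulr_ge0 => //|]; exact: ltW.
have C20 : 0 <= C2.
  by apply: mulr_ge0; rewrite ?sqr_ge0// divr_ge0 ?sqr_ge0// ltW.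
pose Y i w := grad f (zeta k.+1 t w) 0 i / scale t.+1 w i *
             (g t.+2 w 0 i - grad f (theta t.+1 w) 0 i).
have iY i : rintegrable P (Y i).
  apply: (@rintegrableM_bounded _ _ _ _ _ _ (M / eps)).
  - apply: measurable_funM.
      by apply: measurable_grad (ltW L0) Lf _ => j; exact: mzeta.
    by apply: measurable_fun_inv_max => //; exact: mv.
  - move=> w; rewrite normrM; apply: ler_pM => //.
      exact: (le_trans (normr_coord_le_enorm _ _)).
    by rewrite ger0_norm ?adopt_scaleV_ge0// adopt_scaleV_le.
  - by apply: rintegrableB; [exact: rintegrable_g|exact: rintegrable_grad_theta].
have iSY : rintegrable P (fun w => \sum_(i < D) Y i w) by exact: rintegrable_sum.
have EY : \int[P]_w (\sum_(i < D) Y i w) = 0.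
  by rewrite Rexpect_sum// big1// => i _; exact: Rexpect_martingale_term.
have [im Em] := Rexpect_mS2 t.
have i1 := rintegrableZ c (rintegrable_precond t.+1).
have i2 := rintegrableD (rintegrable_f_zeta k t.+1) i1.
have i3 := rintegrableB (rintegrable_f_zeta k.+1 t) (rintegrableZ c iSY).
have i4 := rintegrableD (rintegrable_cst P 1) im.
have i5 := rintegrableZ C1 i4.
have i6 := rintegrableZ C2 (rintegrable_sumsq t.+2).
have i7 := rintegrableD i3 i5.
have b1' : 0 <= b1 <= 1 by rewrite b0 ltW.
have := le_Rexpect i2 (rintegrableD i7 i6)
  (fun w => @adopt_one_step _ _ alpha b1 b2 eps th0 (path w) eps0 f L M k t
              df L0 Lf gM b1' e0).
rewrite (RexpectD (rintegrable_f_zeta k t.+1) i1).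
rewrite (RexpectZ c (rintegrable_precond _)).
rewrite (RexpectD i7 i6) (RexpectD i3 i5) (RexpectZ C2 (rintegrable_sumsq _)).
rewrite (RexpectZ C1 i4) (RexpectD (rintegrable_cst P 1) im) Rexpect_cst.
rewrite (RexpectB (rintegrable_f_zeta _ _) (rintegrableZ c iSY)).
rewrite (RexpectZ c iSY) EY.
rewrite mulr0 subr0 => /le_trans; apply; apply: lerD.
  by rewrite lerD2l; apply: ler_wpM2l => //; rewrite lerD2l.
by apply: ler_wpM2l => //; exact: Rexpect_sumsq.
Qed.

(** Every coordinate scale is at most [eps + sqrt (sum_i v_i)], a common factor that undoes the
    preconditioning. *)
Lemma sqr_enorm_grad_le t w :
  enorm (grad f (theta t w)) ^+ 2 <=
  X t w * (eps + Num.sqrt (\sum_(i < D) v t w 0 i)).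
Proof.
have [v0 _ _] := Rexpect_v t.
rewrite sqr_enorm mulr_suml; apply: ler_sum => i _.
have s0 : 0 < scale t w i by exact: adopt_scale_gt0.
rewrite -[leLHS](divfK (lt0r_neq0 s0)); apply: ler_wpM2l.
  by apply: divr_ge0; rewrite ?sqr_ge0// ltW.
rewrite ge_max; apply/andP; split; last by rewrite lerDl sqrtr_ge0.
apply: ler_wpDl; first exact: ltW.
rewrite ler_wsqrtr// (bigD1 i)//= lerDl sumr_ge0// => j _; exact: v0.
Qed.

Lemma rintegrable_grad_powR t (p : R) : 0 <= p ->
  rintegrable P (fun w => enorm (grad f (theta t w)) `^ p).
Proof.
move=> p0; apply: (@rintegrable_bounded _ _ _ _ _ (M `^ p)).
  apply: (measurableT_comp (measurable_powR p)).
  apply: (measurableT_comp (@measurable_fun_sqrt R)).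
  apply: measurable_sum => i; apply: measurable_funX.
  by apply: measurable_grad (ltW L0) Lf _ => j; exact: mtheta.
move=> w; rewrite ger0_norm ?powR_ge0//.
by apply: ge0_ler_powR => //; rewrite nnegrE// enorm_ge0.
Qed.

(* Young's inequality: with [u = |grad f|], [W = eps + sqrt (sum_i v_i)],
   [x = lam X] and [y = W^2 / lam^2], the bound [u^2 <= X W] gives
   [u^4 <= x^2 y <= (x + y)^3]. *)
Lemma Rexpect_grad_powR t (lam : R) : 0 < lam ->
  \int[P]_w (enorm (grad f (theta t w)) `^ (4 / 3)) <=
  lam * \int[P]_w X t w + lam ^- 2 * (2 * eps ^+ 2 + 2 * G ^+ 2).
Proof.
move=> lam0; have [v0 iv Ev] := Rexpect_v t.
have iX := rintegrableZ lam (rintegrable_precond t).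
have iW := rintegrableD (rintegrable_cst P (2 * eps ^+ 2)) (rintegrableZ 2 iv).
have iW2 := rintegrableZ (lam ^- 2) iW.
have lamV0 : 0 <= lam ^- 2 by rewrite invr_ge0 sqr_ge0.
have p0 : 0 <= 4 / 3 :> R by rewrite divr_ge0.
have le_pt w : enorm (grad f (theta t w)) `^ (4 / 3) <=
    lam * X t w + lam ^- 2 * (2 * eps ^+ 2 + 2 * \sum_(i < D) v t w 0 i).
  have := sqr_enorm_grad_le t w; have := enorm_ge0 (grad f (theta t w)).
  have X0 : 0 <= X t w.
    apply: sumr_ge0 => i _; apply: mulr_ge0; first exact: sqr_ge0.
    exact: adopt_scaleV_ge0.
  have S0 : 0 <= \sum_(i < D) v t w 0 i by apply: sumr_ge0 => i _; exact: v0.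
  have := sqr_sqrtr S0; have := sqrtr_ge0 (\sum_(i < D) v t w 0 i).
  move: (\sum_(i < D) v t w 0 i) S0 (Num.sqrt _) => s s0 r r0 rs.
  move: (enorm _) (X t w) X0 => u x x0 u0 uxW.
  set W := eps + r in uxW; have W0 : 0 <= W by rewrite addr_ge0// ltW.
  set y := lam ^- 2 * W ^+ 2.
  have y0 : 0 <= y by rewrite mulr_ge0// sqr_ge0.
  have lx0 : 0 <= lam * x by rewrite mulr_ge0// ltW.
  have yle : y <= lam ^- 2 * (2 * eps ^+ 2 + 2 * s).
    apply: ler_wpM2l => //; rewrite -rs /W -subr_ge0.
    have -> : 2 * eps ^+ 2 + 2 * r ^+ 2 - (eps + r) ^+ 2 = (eps - r) ^+ 2 by ring.
    exact: sqr_ge0.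
  apply: le_trans (_ : lam * x + y <= _); last by rewrite lerD2l.
  have u4 : u ^+ 4 <= (lam * x + y) ^+ 3.
    have -> : u ^+ 4 = (u ^+ 2) ^+ 2 by rewrite -exprM.
    apply: (@le_trans _ _ ((x * W) ^+ 2)).
      by rewrite ler_sqr ?nnegrE ?sqr_ge0// mulr_ge0.
    have -> : (x * W) ^+ 2 = (lam * x) ^+ 2 * y.
      by rewrite /y; field; exact: lt0r_neq0.
    rewrite [leRHS]exprSr; apply: ler_pM => //; first exact: sqr_ge0.
      by rewrite ler_sqr ?nnegrE ?addr_ge0// lerDl.
    by rewrite lerDr.
  have -> : u `^ (4 / 3) = (u ^+ 4) `^ 3^-1 by rewrite -powR_mulrn// -powRrM.
  have xy0 : 0 <= lam * x + y by rewrite addr_ge0.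
  apply: (@le_trans _ _ (((lam * x + y) ^+ 3) `^ 3^-1)).
    by apply: ge0_ler_powR; rewrite ?nnegrE ?invr_ge0 ?exprn_ge0.
  by rewrite -powR_mulrn// -powRrM mulfV ?pnatr_eq0// powRr1.
apply: (le_trans (le_Rexpect (rintegrable_grad_powR t p0)
  (rintegrableD iX iW2) le_pt)).
rewrite (RexpectD iX iW2) (RexpectZ _ (rintegrable_precond t)) (RexpectZ _ iW).
rewrite lerD2l; apply: ler_wpM2l => //.
rewrite (RexpectD (rintegrable_cst P _) (rintegrableZ 2 iv)) Rexpect_cst.
by rewrite lerD2l (RexpectZ _ iv) ler_wpM2l.
Qed.

Lemma f_inf_le_Rexpect k t : f_inf <= \int[P]_w f (zeta k t w).
Proof.
rewrite -[leLHS](Rexpect_cst P); apply: le_Rexpect.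
- exact: rintegrable_cst.
- exact: rintegrable_f_zeta.
- by move=> w; case/andP: (fb (zeta k t w)).
Qed.

Lemma Rexpect_le_f_sup k t : \int[P]_w f (zeta k t w) <= f_sup.
Proof.
rewrite -[leRHS](Rexpect_cst P); apply: le_Rexpect.
- exact: rintegrable_f_zeta.
- exact: rintegrable_cst.
- by move=> w; case/andP: (fb (zeta k t w)).
Qed.

(** * Lookahead bounds and descent over a window of steps *)

(** A geometric series bound; the induction closes because [a / (1 - b1)] is the fixed point of
    [x = a + b1 * x]. *)
Lemma lookahead_bounds (a : R) k t :
  (forall s, (t <= s)%N -> 0 <= alpha s <= a) ->
  0 <= e k t <= a / (1 - b1).
Proof.
case/andP: (b101) => b0 b1lt; have c0 : 0 < 1 - b1 by rewrite subr_gt0.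
elim: k t => [|k IH] t ha /=.
  rewrite lexx/=; have /andP[h1 h2] := ha t (leqnn t).
  by apply: divr_ge0; [exact: le_trans h2|exact: ltW].
have /andP[h1 h2] : 0 <= e k t.+1 <= a / (1 - b1).
  by apply: IH => s ts; apply: ha; exact: ltnW.
have /andP[h3 h4] := ha t (leqnn t).
rewrite /e/= -/e addr_ge0 ?mulr_ge0//=.
have -> : a / (1 - b1) = a + b1 * (a / (1 - b1)) by field; exact: lt0r_neq0.
by apply: lerD => //; exact: ler_wpM2l.
Qed.

(** Telescoping along an antidiagonal: each step in time uses up one unit of lookahead, so ending
    with [k] after [m] steps means starting with [k + m]. Positive [k] ensures that each step has a
    genuine step size to gain from. *)
Let lookahead_descent (u : nat -> nat -> R) (delta : R) n m k : (0 < k)%N ->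
  (forall k t, (0 < k)%N -> (n <= t < n + m)%N -> u k t.+1 <= u k.+1 t - delta) ->
  u k (n + m)%N <= u (k + m)%N n - m%:R * delta.
Proof.
move=> + hu; elim: m k hu => [|m IH] k hu k0; first by rewrite !addn0 mul0r subr0.
rewrite addnS; apply: (le_trans (hu _ _ k0 _)).
  by rewrite leq_addr addnS leqnn.
have := IH k.+1 _ isT; rewrite addSnnS -natr1 => /(_ _)/le_trans h.
rewrite lerBlDr; apply: h => [k' t k'0 /andP[t1 t2]|].
  by apply: hu => //; rewrite t1 addnS ltnW.
by rewrite mulrDl mul1r opprD addrA subrK.
Qed.

Variables (a1 a2 : R).
Hypothesis a10 : 0 < a1.
Hypothesis a12 : a1 <= a2.
Hypothesis alphaP : forall t, (0 < t)%N ->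
  a1 / Num.sqrt t%:R <= alpha t <= a2 / Num.sqrt t%:R.

(** Otherwise each of [n + 1] consecutive steps would lower the expected potential by more than its
    share of [f_sup - f_inf]. *)
Lemma exists_small_precond : exists2 K : R, 0 <= K & forall n,
  exists2 t, (n < t <= n.*2.+1)%N & \int[P]_w X t w <= K / Num.sqrt n.+1%:R.
Proof.
case/andP: (b101) => b0 b1lt; have c0 : 0 < 1 - b1 by rewrite subr_gt0.
pose C1 := L * M / eps * (1 + G ^+ 2 / eps ^+ 2).
pose C2 := L / eps ^+ 2 * G ^+ 2.
pose q := a2 / (1 - b1).
(* With the lookahead at most [q / sqrt (n + 1)] on the window, [C3 / (n + 1)] bounds both quadratic
   errors of one step. *)
pose C3 := (1 - b1) * q ^+ 2 * C1 + ((1 - b1) * q) ^+ 2 * C2.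
(* For [r = 1 / sqrt (n + 1)], the gain [(1 - b1) * (a1 / 2 * r) * (K * r)] then equals
   [r^2 (f_sup - f_inf + 1 + C3)]: the share of [C3] pays for the errors, and the rest adds up to
   [f_sup - f_inf + 1] over the window. *)
pose K := (f_sup - f_inf + 1 + C3) * 2 / ((1 - b1) * a1).
have C10 : 0 <= C1.
  apply: mulr_ge0; last by rewrite addr_ge0// divr_ge0 ?sqr_ge0.
  by apply: divr_ge0; [apply: mulr_ge0 => //|]; exact: ltW.
have C20 : 0 <= C2 by rewrite mulr_ge0 ?sqr_ge0// divr_ge0 ?sqr_ge0// ltW.
have C30 : 0 <= C3.
  apply: addr_ge0; last by apply: mulr_ge0 => //; exact: sqr_ge0.
  by apply: mulr_ge0 => //; apply: mulr_ge0; [exact: ltW|exact: sqr_ge0].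
have F0 : 0 <= f_sup - f_inf.
  by rewrite subr_ge0; have /andP[h1 h2] := fb th0; exact: le_trans h2.
have K0 : 0 <= K.
  apply: divr_ge0; last by apply: mulr_ge0; exact: ltW.
  by apply: mulr_ge0 => //; apply: addr_ge0 => //; exact: addr_ge0.
exists K => // n; apply: contrapT => noT.
pose r : R := (Num.sqrt n.+1%:R)^-1.
have r0 : 0 < r by rewrite invr_gt0 sqrtr_gt0.
have r2 : n.+1%:R * r ^+ 2 = 1.
  by rewrite exprVn sqr_sqrtr// mulfV// pnatr_eq0.
have big_t t : (n < t <= n.*2.+1)%N -> K * r < \int[P]_w X t w.
  by move=> nt; rewrite ltNge; apply/negP => h; apply: noT; exists t.
have alpha_le s : (n < s)%N -> 0 <= alpha s <= a2 * r.
  move=> ns; have /andP[h1 h2] := alphaP (leq_ltn_trans (leq0n n) ns).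
  apply/andP; split.
    by apply: le_trans h1; rewrite divr_ge0 ?sqrtr_ge0// ltW.
  apply: (le_trans h2); apply: ler_wpM2l.
    by apply: le_trans a12; exact: ltW.
  rewrite /r lef_pV2 ?posrE ?sqrtr_gt0 ?ltr0n//; last exact: leq_ltn_trans ns.
  by rewrite ler_wsqrtr// ler_nat.
(* Since [s <= 2n + 2 <= 4 (n + 1)], its root is at most [2 sqrt (n + 1)]. The range ends at
   [2n + 2] because the step at [t <= 2n] involves [alpha (t + 2)]. *)
have alpha_ge s : (n < s <= n.*2.+2)%N -> a1 / 2 * r <= alpha s.
  move=> /andP[ns sn]; have /andP[h1 _] := alphaP (leq_ltn_trans (leq0n n) ns).
  apply: le_trans h1; rewrite -mulrA; apply: ler_wpM2l; first exact: ltW.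
  rewrite /r -invfM lef_pV2 ?posrE ?mulr_gt0 ?sqrtr_gt0 ?ltr0n//; last first.
    exact: leq_ltn_trans ns.
  have -> : 2 = Num.sqrt 4 :> R.
    by rewrite (_ : 4 = 2 ^+ 2) ?sqrtr_sqr ?ger0_norm// -natrX.
  rewrite -sqrtrM// ler_wsqrtr// -natrM ler_nat (leq_trans sn)//.
  by rewrite -doubleS -muln2 mulnC leq_mul2r orbT.
have step k t : (0 < k)%N -> (n <= t < n + n.+1)%N ->
    \int[P]_w f (zeta k t.+1 w) <=
    \int[P]_w f (zeta k.+1 t w) - r ^+ 2 * (f_sup - f_inf + 1).
  case: k => // k _ /andP[nt tn].
  have /andP[e0 eq] : 0 <= e k.+1 t.+2 <= a2 * r / (1 - b1).
    apply: lookahead_bounds => s ts; apply: alpha_le.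
    by apply: leq_trans ts; rewrite ltnS (leq_trans nt).
  (* The first term [alpha t.+2] of the lookahead already suffices; the others are nonnegative. *)
  have el : a1 / 2 * r <= e k.+1 t.+2.
    rewrite /e/=; apply: ler_wpDr.
      apply: mulr_ge0 => //.
      have /andP[] // : 0 <= e k t.+3 <= a2 * r / (1 - b1).
      apply: lookahead_bounds => s ts; apply: alpha_le.
      by apply: leq_trans ts; rewrite ltnS (leq_trans nt)// ltnW.
    apply: alpha_ge; rewrite ltnS (leq_trans nt)//= !ltnS -addnn.
    by rewrite addnS ltnS in tn.
  have := Rexpect_one_step e0.
  have /ltW bt : K * r < \int[P]_w X t.+1 w.
    apply: big_t; rewrite ltnS nt/= ltnS -addnn.
    by rewrite addnS ltnS in tn.
  set EX := \int[P]_w X t.+1 w in bt *; set ek := e k.+1 t.+2 in e0 eq el *.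
  have {}eq : ek <= q * r by rewrite /q mulrAC.
  have q0 : 0 <= q by rewrite divr_ge0 ?ltW// (lt_le_trans a10).
  have e2 : ek ^+ 2 <= q ^+ 2 * r ^+ 2.
    by rewrite -exprMn ler_sqr ?nnegrE// mulr_ge0// ltW.
  have g1 : (1 - b1) * ek * ek * (L * M / eps) * (1 + G ^+ 2 / eps ^+ 2) +
      ((1 - b1) * ek) ^+ 2 * (L / eps ^+ 2) * G ^+ 2 <= C3 * r ^+ 2.
    have -> : (1 - b1) * ek * ek * (L * M / eps) * (1 + G ^+ 2 / eps ^+ 2) +
        ((1 - b1) * ek) ^+ 2 * (L / eps ^+ 2) * G ^+ 2 =
        ((1 - b1) * C1 + (1 - b1) ^+ 2 * C2) * ek ^+ 2.
      by rewrite /C1 /C2; ring.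
    have -> : C3 * r ^+ 2 =
        ((1 - b1) * C1 + (1 - b1) ^+ 2 * C2) * (q ^+ 2 * r ^+ 2).
      by rewrite /C3; ring.
    apply: ler_wpM2l => //; apply: addr_ge0; last by rewrite mulr_ge0// sqr_ge0.
    by apply: mulr_ge0 => //; exact: ltW.
  have g2 : r ^+ 2 * (f_sup - f_inf + 1 + C3) <= (1 - b1) * ek * EX.
    have -> : r ^+ 2 * (f_sup - f_inf + 1 + C3) =
        (1 - b1) * (a1 / 2 * r) * (K * r).
      by rewrite /K; field; rewrite !lt0r_neq0.
    apply: ler_pM => //.
    - by apply: mulr_ge0; [exact: ltW|apply: mulr_ge0; rewrite ?divr_ge0// ltW].
    - by apply: mulr_ge0 => //; exact: ltW.
    - by apply: ler_wpM2l => //; exact: ltW.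
  move=> h; lra.
(* From lookahead [n + 2] at time [n] to lookahead [1] at time [2n + 1], the potential drops by
   [f_sup - f_inf + 1], more than its range allows. *)
have := lookahead_descent (u := fun k t => \int[P]_w f (zeta k t w))
  (ltn0Sn 0) step.
rewrite mulrA r2 mul1r => h.
have := f_inf_le_Rexpect 1 (n + n.+1); have := Rexpect_le_f_sup (1 + n.+1) n; lra.
Qed.

End adopt_expectations.

(** * From a small preconditioned gradient to the rate for the [4/3] moment *)

Theorem theoremE1 (R : realType) (D : nat) (d : measure_display)
  (Omega : measurableType d) (P : probability Omega R)
  (f : 'rV[R]_D -> R) (L f_inf f_sup beta1 beta2 eps a1 a2 G : R)
  (alpha : nat -> R) (theta0 : 'rV[R]_D) (g : nat -> Omega -> 'rV[R]_D) :
  (forall x, differentiable f x) ->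
  0 < L -> L_smooth L f ->
  (forall x, f_inf <= f x <= f_sup) ->
  0 <= beta1 < 1 -> 0 <= beta2 < 1 -> 0 < eps ->
  0 < a1 -> a1 <= a2 ->
  (forall t : nat, (0 < t)%N ->
     a1 / Num.sqrt t%:R <= alpha t <= a2 / Num.sqrt t%:R) ->
  0 < G ->
  (* each g_t is a random vector *)
  (forall (t : nat) (i : 'I_D), measurable_fun setT (fun w => g t w 0 i)) ->
  (* E ||g_t||^2 <= G^2 for all t >= 0 *)
  (forall t : nat,
     (\int[P]_w ((enorm (g t w)) ^+ 2)%:E <= (G ^+ 2)%:E)%E) ->
  (* E[g_t | g_0, ..., g_{t-1}] = grad f (theta_{t-1}) for t >= 1 *)
  (forall t : nat, (0 < t)%N -> forall (i : 'I_D) (A : set Omega),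
     past_sigma g t A ->
     (\int[P]_(w in A) (g t w 0 i)%:E =
      \int[P]_(w in A)
        ((grad f (adopt_theta alpha beta1 beta2 eps theta0
                    (fun s => g s w) t.-1)) 0 i)%:E)%E) ->
  exists K : R, forall T : nat, (1 <= T)%N ->
    (\big[Order.min/+oo]_(1 <= t < T.+1)
       poweR (\int[P]_w
                (powR (enorm (grad f (adopt_theta alpha beta1 beta2 eps theta0
                                        (fun s => g s w) t.-1))) (4 / 3))%:E)
             (3 / 2)
     <= (K / Num.sqrt T%:R)%:E)%E.
Proof.
move=> df L0 Lf fb b1P b2P eps0 a10 a12 alphaP G0 mg Eg2 condE.
pose M := Num.sqrt (4 * L * (f_sup - f_inf)).
have gM x : enorm (grad f x) <= M.
  rewrite -[leLHS]ger0_norm ?enorm_ge0// -sqrtr_sqr ler_wsqrtr//.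
  exact: bounded_smooth_grad_bounded.
have M0 : 0 <= M by exact: sqrtr_ge0.
have condE' t i (A : set Omega) : past_sigma g t.+1 A ->
    (\int[P]_(w in A) (g t.+1 w 0 i)%:E =
     \int[P]_(w in A) (grad f (adopt_theta alpha beta1 beta2 eps theta0
        (fun s => g s w) t) 0 i)%:E)%E by exact: condE.
have [K1 K10 hK1] := exists_small_precond df L0 Lf fb gM b1P eps0 mg Eg2
  condE' a10 a12 alphaP.
pose K2 := 2 * eps ^+ 2 + 2 * G ^+ 2.
have K20 : 0 <= K2 by rewrite addr_ge0// mulr_ge0// sqr_ge0.
pose u t w := enorm (grad f (adopt_theta alpha beta1 beta2 eps theta0
                                        (fun s => g s w) t)).
have p0 : 0 <= 4 / 3 :> R by rewrite divr_ge0.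
have q0 : 0 <= 3 / 2 :> R by rewrite divr_ge0.
have iu t : rintegrable P (fun w => u t w `^ (4 / 3)).
  exact: (rintegrable_grad_powR P beta1 beta2 alpha theta0 L0 Lf gM eps0 mg).
have Eu0 t : 0 <= \int[P]_w (u t w `^ (4 / 3)).
  by apply: Rintegral_ge0 => w _; exact: powR_ge0.
(* The first summand serves [T >= 2]. The second covers [T = 1], where only [theta_0] is available
   and no window fits, through the gradient bound [M]. *)
exists ((K1 + K2) `^ (3 / 2) * 2 + (M `^ (4 / 3)) `^ (3 / 2)) => T T1.
suff [t tT ht] : exists2 t, (t < T)%N &
    (\int[P]_w (u t w `^ (4 / 3))) `^ (3 / 2) <=
    ((K1 + K2) `^ (3 / 2) * 2 + (M `^ (4 / 3)) `^ (3 / 2)) / Num.sqrt T%:R.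
  apply: le_trans (ge_bigmin_seq _ t.+1 _ _ _ _) _ => //=.
    by rewrite mem_index_iota.
  by rewrite (RexpectE (iu t)) poweR_EFin lee_fin.
case: T T1 => // -[_|T _].
  exists 0 => //; rewrite sqrtr1 divr1; apply: ler_wpDl.
    by rewrite mulr_ge0// powR_ge0.
  apply: ge0_ler_powR => //; rewrite ?nnegrE ?powR_ge0//.
  rewrite -[leRHS](Rexpect_cst P); apply: le_Rexpect => //.
    exact: rintegrable_cst.
  move=> w; apply: ge0_ler_powR; rewrite ?nnegrE ?enorm_ge0//; exact: gM.
(* The horizon is now [T.+2]: the window ends at [2n + 1 <= T + 1], while [T + 2 <= 4 (n + 1)] keeps
   [n] comparable to the horizon. *)
pose n := T./2; have [t /andP[nt tn] ht] := hK1 n.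
have nT : (n.*2 <= T)%N by rewrite -[leqRHS]odd_double_half leq_addl.
have Tn : (T.+2 <= 4 * n.+1)%N.
  have Tn2 : (T < n.+1.*2)%N by rewrite -ltn_half_double.
  by rewrite -[X in (X * _)%N]/(2 + 2)%N mulnDl mul2n -addn1 leq_add.
exists t; first by rewrite ltnS (leq_trans tn)// ltnS.
(* With [lam = q^-1] both Young terms have order [q^2], since [q^-1 / sqrt (n + 1) = q^-1 * q^3];
   the final power [3 / 2] turns [q^2] into [q^3 = 1 / sqrt (n + 1)]. *)
pose q : R := n.+1%:R `^ (- (6^-1)).
have nq0 : 0 < q by exact: powR_gt0.
have q3 : q ^+ 3 = (Num.sqrt n.+1%:R)^-1.
  rewrite -powR_mulrn ?ltW// -powRrM -powR12_sqrt// -powRN; congr (_ `^ _).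
  by field.
have qV0 : 0 < q^-1 by rewrite invr_gt0.
have hE := Rexpect_grad_powR beta1 alpha theta0 L0 Lf gM b2P eps0 mg Eg2 t qV0.
have {hE} hE : \int[P]_w (u t w `^ (4 / 3)) <= (K1 + K2) * q ^+ 2.
  apply: (le_trans hE); rewrite exprVn invrK -/K2 mulrDl; apply: lerD.
    rewrite mulrC ler_pdivrMr// -mulrA -exprSr q3; exact: ht.
  by rewrite mulrC.
apply: (@le_trans _ _ (((K1 + K2) * q ^+ 2) `^ (3 / 2))).
  apply: ge0_ler_powR => //; rewrite nnegrE; first exact: Eu0.
  by apply: mulr_ge0; [exact: addr_ge0|exact: sqr_ge0].
rewrite (powRM _ (addr_ge0 K10 K20) (sqr_ge0 q)).
have -> : (q ^+ 2) `^ (3 / 2) = (Num.sqrt n.+1%:R)^-1.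
  rewrite -(powR_mulrn 2 (ltW nq0)) -powRrM -q3 -(powR_mulrn 3 (ltW nq0)).
  by congr (_ `^ _); field.
rewrite [leRHS]mulrDl; apply: ler_wpDr.
  by rewrite divr_ge0 ?powR_ge0 ?sqrtr_ge0.
rewrite -mulrA; apply: ler_wpM2l; first exact: powR_ge0.
(* The factor [2] of the constant absorbs [sqrt (T + 2) <= 2 sqrt (n + 1)]. *)
have -> : 2 = Num.sqrt 4 :> R.
  by rewrite (_ : 4 = 2 ^+ 2) ?sqrtr_sqr ?ger0_norm// -natrX.
rewrite ler_pdivlMr ?sqrtr_gt0 ?ltr0n// mulrC ler_pdivrMr ?sqrtr_gt0 ?ltr0n//.
by rewrite -sqrtrM// ler_wsqrtr// -natrM ler_nat.
Qed.
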